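(* Let $R$ be an integral domain which is not a field and let $A$ be a nonempty set. Then the free $R$-module $R(A)$ on the set $A$ has a proper essential submodule.
   Context: A proper essential submodule of a module $M$ is a submodule $E$ of $M$ with $E\neq\{0_M\}$, $E\neq M$, such that $E\cap N\neq\{0_M\}$ for every nonzero submodule $N$ of $M$. *)

(* Defs.v *)
From HB Require Import structures.
From mathcomp Require Import all_boot all_order all_algebra.
From mathcomp Require Import boolp classical_sets.
From mathcomp Require Import monalg.

Set Implicit Arguments.
Unset Strict Implicit.
Unset Printing Implicit Defensive.

Import GRing.Theory.
Local Open Scope ring_scope.
Local Open Scope classical_set_scope.

(* MathComp's GRing.submod_closed for an arbitrary Prop-valued subset, so that
   quantification over submodules is not restricted to decidable ones. *)
Definition is_submodule (R : pzRingType) (M : lmodType R) (N : set M) : Prop :=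
  GRing.submod_closed [in N].

Definition proper_essential_submodule (R : pzRingType) (M : lmodType R)
    (E : set M) : Prop :=
  [/\ is_submodule E,
      E <> [set 0],
      E <> setT &
      forall N : set M, is_submodule N -> N <> [set 0] -> E `&` N <> [set 0]].

(* {malg R[A]} consists of the finitely supported functions A -> R with the
   pointwise operations; A carries no monoid structure here, so this is only
   the R-module, with basis the indicator functions << a >> of the a in A. *)
Definition free_module (R : idomainType) (A : choiceType) : lmodType R :=
  {malg R[A]}.

(* Main.v *)
Require Import Defs.
From mathcomp Require Import all_boot all_order all_algebra.
From mathcomp Require Import boolp classical_sets.
From mathcomp Require Import monalg.

(** For a nonzero nonunit [r], the submodule [r R(A)] works. It is proper since
    [<< a >> = r x] would make [r] a unit (read off the coefficient at [a]), and
    essential since [r n] is a nonzero element of [r R(A)] and of [N] for every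
    nonzero [n] in [N], as [R(A)] is torsion-free. *)

Set Implicit Arguments.
Unset Strict Implicit.
Unset Printing Implicit Defensive.

Import GRing.Theory.
Local Open Scope ring_scope.
Local Open Scope classical_set_scope.

Lemma not_field_axiomP (R : idomainType) :
  ~ GRing.field_axiom R -> exists2 r : R, r != 0 & r \isn't a GRing.unit.
Proof.
move=> /existsNP[r /not_implyP[r0 /negP rU]].
by exists r.
Qed.

(** Torsion-freeness is checked coefficientwise: each coefficient of [r *: x] is [r] times that of
    [x], and [R] has no zero divisors. *)
Lemma malg_scaler_eq0 (R : idomainType) (A : choiceType) (r : R)
    (x : {malg R[A]}) : (r *: x == 0) = (r == 0) || (x == 0).
Proof.
apply/eqP/orP => [rx0 | [/eqP-> | /eqP->]]; rewrite ?scale0r ?scaler0 //.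
have [_|r0] := eqVneq r 0; [by left | right].
apply/eqP/malgP => a; have /malgP/(_ a)/eqP := rx0.
by rewrite mcoeffZ !mcoeff0 mulf_eq0 (negbTE r0) => /eqP.
Qed.

Section Submodules.
Variables (R : comPzRingType) (M : lmodType R).

Lemma submodule0 (N : set M) : is_submodule N -> N 0.
Proof. by case=> /set_mem. Qed.

Lemma submoduleZ (N : set M) (r : R) (x : M) :
  is_submodule N -> N x -> N (r *: x).
Proof.
(* Closure is stated for combinations [r *: x + y]; take [y = 0]. *)
case=> N0 NL Nx; apply/set_mem; rewrite -[_ *: _]addr0.
by apply: NL => //; apply/mem_set.
Qed.

(** As [0] lies in [N], differing from [[set 0]] forces a further element, obtained classically. *)
Lemma submodule_neq0 (N : set M) :
  is_submodule N -> N <> [set 0] -> exists2 x, N x & x != 0.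
Proof.
move=> sN nN0; apply: contrapT => noN; apply: nN0; apply/seteqP.
split=> [x Nx /=|x ->]; last exact: submodule0.
by apply: contrapT => /eqP x0; apply: noN; exists x.
Qed.

(** Commutativity of [R] lets a scalar [s] move past [r], so that [s *: (r *: x)] is again a
    multiple of [r]. *)
Lemma is_submodule_range_scale (r : R) :
  is_submodule (range (fun x : M => r *: x)).
Proof.
split; first by apply/mem_set; exists 0; rewrite ?scaler0.
move=> s _ _ /set_mem[x _ <-] /set_mem[y _ <-]; apply/mem_set.
by exists (s *: x + y); rewrite ?scalerDr // !scalerA mulrC.
Qed.

End Submodules.

Theorem theorem2p2 (R : idomainType) (A : choiceType)
    (hR : ~ GRing.field_axiom R) (hA : inhabited A) :
  exists E : set (free_module R A), proper_essential_submodule E.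
Proof.
have [r r0 rU] := not_field_axiomP hR; have [a] := hA.
have ua0 : << a >> != 0 :> {malg R[A]}.
  by apply/eqP => /malgP/(_ a)/eqP; rewrite mcoeffUU mcoeff0 oner_eq0.
exists (range (fun x : free_module R A => r *: x)); split.
- exact: is_submodule_range_scale.
(* The range is nonzero: it contains [r *: << a >>], a nonzero multiple of a basis element. *)
- move=> E0; have : [set (0 : free_module R A)] (r *: << a >>).
    by rewrite -E0; exists << a >>.
  by move=> /eqP; rewrite malg_scaler_eq0 (negbTE r0) (negbTE ua0).
- move=> ET; have [x _ /malgP/(_ a)] :
      range (fun x : free_module R A => r *: x) << a >> by rewrite ET.
  rewrite mcoeffZ mcoeffUU mulrC => xr1.
  by case/negP: rU; apply/unitrPr; exists x@_a; rewrite mulrC.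
- move=> N sN /(submodule_neq0 sN)[n Nn n0] EN0.
  have : [set (0 : free_module R A)] (r *: n).
    by rewrite -EN0; split; [exists n | exact: submoduleZ].
  by move=> /eqP; rewrite malg_scaler_eq0 (negbTE r0) (negbTE n0).
Qed.
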